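(* Let $\mathbb{E}^4$ be the Engel group given by $(\mathbb{R}^4,\mathcal{H})$, where the distribution $\mathcal{H}$ is generated by $$X_1=\partial_{x_1},\qquad X_2=\partial_{x_2}+x_1\partial_{x_3}+x_3\partial_{x_4}.$$ Let $\Omega\subset\mathbb{R}^2$ be a bounded open set. Then the immersion $\Upsilon:\Omega\to\mathbb{E}^4$ of degree $3$ given by $$\Upsilon(v,w)=(v,0,w,0)$$ is isolated.
   Context: **Filtration and degree.** The Engel group carries the filtration $\mathcal H^1=\mathcal H=\mathrm{span}\{X_1,X_2\}$, $\mathcal H^2=\mathrm{span}\{X_1,X_2,X_3\}$, $\mathcal H^3=T\mathbb R^4=\mathrm{span}\{X_1,X_2,X_3,X_4\}$ with $X_3=\partial_{x_3}$, $X_4=\partial_{x_4}$. So $\deg X_1=\deg X_2=1$, $\deg X_3=2$, $\deg X_4=3$, and $\deg(X_i\wedge X_j)=\deg X_i+\deg X_j$ for $i<j$. The degree of a $2$-vector $\sum_{i<j}\lambda_{ij}(X_i\wedge X_j)_p$ is the maximum of $\deg(X_i\wedge X_j)$ over the pairs with $\lambda_{ij}\ne0$. The degree of an immersed surface is the maximum over its points of the degree of the $2$-vector $e_1\wedge e_2$, where $e_1,e_2$ is a basis of the tangent plane. **Admissible variation.** The ambient manifold is endowed with a Riemannian metric $g$. An admissible variation of $\Upsilon$ is a smooth map $\Gamma:\Omega\times(-\varepsilon,\varepsilon)\to\mathbb E^4$, with $\Gamma_s=\Gamma(\cdot,s)$, such that $\Gamma_0=\Upsilon$, $\Gamma_s$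 is an immersion of the same degree as $\Upsilon$ (namely $3$) for small enough $s$, and $\Gamma_s=\Upsilon$ outside a given compact subset of $\Omega$. **Isolated.** An immersion $\Phi:\bar M\to N$ in an equiregular graded manifold (a manifold with a filtration $\mathcal H^1\subset\dots\subset\mathcal H^s=TN$ by sub-bundles of constant rank satisfying $[\mathcal H^i,\mathcal H^j]\subset\mathcal H^{i+j}$, where $\mathcal H^k=TN$ for $k\ge s$; here $N=\mathbb E^4$) is isolated if the only admissible variation normal to $M=\Phi(\bar M)$ is the trivial one. Normality is understood with respect to $g$, and the trivial variation is the one with $\Gamma_s=\Phi$ for all $s$.
   Formalization: Normality is required of the velocity with respect to the moving surface at every small s (not only to M at s=0), and triviality is concluded only for those s for which the variation is assumed to be an immersion of degree 3, since otherwise the claim is false. *)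

(* Defs.v *)
(* MathComp-Analysis; R^n is 'rV[R]_n, with coordinates numbered from 0. *)
From HB Require Import structures.
From mathcomp Require Import all_boot all_order all_algebra.
From mathcomp Require Import all_classical all_reals all_analysis.

Set Implicit Arguments.
Unset Strict Implicit.
Unset Printing Implicit Defensive.

Import Order.TTheory GRing.Theory Num.Theory.
Import numFieldNormedType.Exports.

Local Open Scope classical_set_scope.
Local Open Scope ring_scope.

(* Meant for U open in a finite-dimensional space: there, f is of class C^k+1
   iff it is differentiable and all its directional derivatives are C^k. *)
Fixpoint Ck (R : realType) (V W : normedModType R) (U : set V) (k : nat)
    (f : V -> W) : Prop :=
  match k with
  | 0 => forall x, U x -> {for x, continuous f}
  | k'.+1 => (forall x, U x -> differentiable f x) /\
             (forall v, Ck U k' (fun x => 'D_v f x))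
  end.

Definition smooth (R : realType) (V W : normedModType R) (U : set V)
    (f : V -> W) : Prop :=
  forall k, Ck U k f.

Section Metric.
Variable R : realType.
Implicit Types (g : 'rV[R]_4 -> 'M[R]_4) (p u v : 'rV[R]_4).

(* [g p] is the Gram matrix at p of the coordinate fields. *)
Definition inner g p u v : R := (u *m g p *m v^T) 0 0.

Definition riemannian_metric g : Prop :=
  [/\ smooth setT g,
      forall p, (g p)^T = g p
    & forall p u, u != 0 -> 0 < inner g p u u].

End Metric.

Section Engel.
Variable R : realType.
Implicit Types (p u v : 'rV[R]_4).

Definition vec4 (a b c d : R) : 'rV[R]_4 := \row_(j < 4) [:: a; b; c; d]`_j.

Definition engel_X (i : 'I_4) p : 'rV[R]_4 :=
  nth 0 [:: vec4 1 0 0 0;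
            vec4 0 1 (p 0 0) (p 0 2);
            vec4 0 0 1 0;
            vec4 0 0 0 1] i.

Definition engel_frame p : 'M[R]_4 := \matrix_(i < 4) engel_X i p.

Definition engel_deg (i : 'I_4) : nat := nth 0%N [:: 1; 1; 2; 3]%N i.

(* u = \sum_i engel_coord p u 0 i *: engel_X i p: the frame is unitriangular,
   hence invertible. *)
Definition engel_coord p u : 'rV[R]_4 := u *m invmx (engel_frame p).

(* The coefficient of X_i /\ X_j in u /\ v at p, for i < j. *)
Definition wedge_coef p u v (i j : 'I_4) : R :=
  engel_coord p u 0 i * engel_coord p v 0 j -
  engel_coord p u 0 j * engel_coord p v 0 i.

Definition wedge_degree p u v : nat :=
  (\max_(ij : 'I_4 * 'I_4 |
      (ij.1 < ij.2)%N && (wedge_coef p u v ij.1 ij.2 != 0%R))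
    (engel_deg ij.1 + engel_deg ij.2))%N.

End Engel.

Section Surfaces.
Variable R : realType.
Implicit Types (Omega : set 'rV[R]_2) (Phi Psi : 'rV[R]_2 -> 'rV[R]_4).
Implicit Types (x : 'rV[R]_2) (Gamma : 'rV[R]_2 -> R -> 'rV[R]_4).

(* Vectors are rows, so row i of the Jacobian is the i-th partial derivative;
   at an immersed point the two rows are a basis of the tangent plane. *)
Definition tangent Phi x (i : 'I_2) : 'rV[R]_4 := row i (jacobian Phi x).

Definition immersion Omega Phi : Prop :=
  smooth Omega Phi /\ (forall x, Omega x -> row_free (jacobian Phi x)).

Definition degree_at Phi x : nat :=
  wedge_degree (Phi x) (tangent Phi x 0) (tangent Phi x 1).

(* d is the maximum of the pointwise degrees; an empty surface has no degree. *)
Definition has_degree Omega Phi (d : nat) : Prop :=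
  (forall x, Omega x -> (degree_at Phi x <= d)%N) /\
  (exists2 x, Omega x & degree_at Phi x = d).

Definition same_degree Omega Phi Psi : Prop :=
  forall d, has_degree Omega Phi d <-> has_degree Omega Psi d.

(* The maps [Gamma ^~ s] are defined for |s| < eps, and |s| < delta is the
   range of small enough s for which they are immersions of unchanged degree. *)
Definition admissible_variation Omega Phi (eps delta : R) Gamma : Prop :=
  [/\ smooth [set z : 'rV[R]_2 * R | Omega z.1 /\ `|z.2| < eps]
             (fun z => Gamma z.1 z.2),
      forall x, Omega x -> Gamma x 0 = Phi x,
      forall s, `|s| < delta ->
        immersion Omega (Gamma ^~ s) /\ same_degree Omega Phi (Gamma ^~ s)
    & exists K : set 'rV[R]_2,
        [/\ compact K, K `<=` Omega
          & forall x s, Omega x -> ~ K x -> `|s| < eps -> Gamma x s = Phi x]].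

(* The velocity is normal to the moving surface at every time of the range, and
   not only at s = 0. Orthogonality at s = 0 alone would leave room for
   tangential motions of second order in s, such as Phi (x + s ^+ 2 *: f x) with
   f compactly supported, and no nonempty surface would be isolated. *)
Definition normal_variation (g : 'rV[R]_4 -> 'M[R]_4) Omega (delta : R) Gamma
    : Prop :=
  forall x s, Omega x -> `|s| < delta ->
    forall i, inner g (Gamma x s) (derive1 (Gamma x) s) (tangent (Gamma ^~ s) x i)
              = 0.

Definition isolated_immersion (g : 'rV[R]_4 -> 'M[R]_4) Omega Phi : Prop :=
  forall (eps delta : R) Gamma, 0 < delta -> delta <= eps ->
    admissible_variation Omega Phi eps delta Gamma ->
    normal_variation g Omega delta Gamma ->
    forall x s, Omega x -> `|s| < delta -> Gamma x s = Phi x.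

Definition Upsilon (x : 'rV[R]_2) : 'rV[R]_4 := vec4 (x 0 0) 0 (x 0 1) 0.

End Surfaces.

(* Main.v *)
(* Degree at most 3 means that the contact form dx_3 - x_2 dx_1 (coordinates
   numbered from 0) pulls back to zero, and its exterior derivative then gives
   dF_2 /\ dF_1 = 0. As long as the second partial derivative of F_2 does not
   vanish, this is a linear transport equation for F_1, and a maximum principle
   forces the compactly supported F_1, and then F_3, to vanish. So all surfaces
   close to Upsilon stay in the plane {x_1 = x_3 = 0}, where a normal velocity
   is also tangent, hence zero. The set of times at which the variation equals
   Upsilon is therefore open; it is closed and contains 0. *)

Require Import Defs.
From HB Require Import structures.
From mathcomp Require Import all_boot all_order all_algebra.
From mathcomp Require Import all_classical all_reals all_analysis.
From mathcomp Require Import ring lra.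

Set Implicit Arguments.
Unset Strict Implicit.
Unset Printing Implicit Defensive.

Import Order.TTheory GRing.Theory Num.Theory.
Import numFieldNormedType.Exports.

Local Open Scope classical_set_scope.
Local Open Scope ring_scope.

(** * Calculus in normed spaces: local maxima, symmetry of second derivatives, maximum principle *)

Lemma is_derive_line (R : realType) (V W : normedModType R) (f : V -> W)
    (v x : V) (t : R) (l : W) :
  is_derive (t *: v + x) v f l ->
  is_derive t 1 (fun r : R => f (r *: v + x)) l.
Proof.
move=> [df dl].
have E : (fun h : R => h^-1 *: (((fun r : R => f (r *: v + x)) \o shift t)
                                  (h *: (1 : R)) - f (t *: v + x))) =
         (fun h => h^-1 *: ((f \o shift (t *: v + x)) (h *: v) -
                            f (t *: v + x))).
  apply/funext => h /=; congr (_ *: (f _ - _)).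
  by rewrite scalerDl -addrA; congr (_ *: _ + _); rewrite /GRing.scale /= mulr1.
by split; rewrite /derivable /derive E.
Qed.

(** Fermat's criterion, obtained by restricting [f] to the line [t *: v + x], where the one-variable
    statement applies. *)
Lemma derive_local_max (R : realType) (V : normedModType R) (f : V -> R)
    (v x : V) :
  (\forall y \near x, derivable f y v) ->
  (\forall y \near x, f y <= f x) -> 'D_v f x = 0.
Proof.
move=> df fx.
have c0 : (fun t : R => t *: v + x) @ (0 : R) --> x.
  rewrite -[X in _ --> X]add0r -[X in _ --> X + _](scale0r v).
  by apply: cvgD; [apply: cvgZr_tmp; exact: cvg_id | exact: cvg_cst].
have [e /= e0 H] : \forall t \near (0 : R),
    derivable f (t *: v + x) v /\ f (t *: v + x) <= f x.
  have n1 := c0 _ df; have n2 := c0 _ fx.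
  by near=> t; split; near: t.
have inb t : t \in `](- e), e[%R -> ball (0 : R) e t.
  by rewrite in_itv /= /ball /= sub0r normrN ltr_norml.
have Z : 0 \in `](- e), e[%R by rewrite in_itv /= oppr_lt0 e0.
have dZ := is_derive_line (derivableP (proj1 (H _ (inb _ Z)))).
have : is_derive (0 : R) (1 : R) (fun r : R => f (r *: v + x)) 0.
  apply: (@derive1_at_max _ _ (- e) e) => //.
  - by rewrite ge0_cp// ltW.
  - move=> t /inb /H[d _]; apply: ex_derive; exact/is_derive_line/derivableP.
  - by move=> t /inb /H[_]; rewrite scale0r add0r.
by move=> /@derive_val; rewrite (@derive_val _ _ _ _ _ _ _ dZ) scale0r add0r.
Unshelve. all: by end_near.
Qed.

(** Two uses of the mean value theorem: along [u] for the difference of [f] across the shift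
    [h *: v], then along [v] for [fu] at the point found. *)
Lemma second_difference (R : realType) (V : normedModType R) (U : set V)
    (f fu fuv : V -> R) (u v x : V) (h : R) :
  0 <= h ->
  (forall y, U y -> is_derive y u f (fu y)) ->
  (forall y, U y -> is_derive y v fu (fuv y)) ->
  (forall a b, 0 <= a <= h -> 0 <= b <= h -> U (a *: u + (b *: v + x))) ->
  exists a b, [/\ 0 <= a <= h, 0 <= b <= h &
    f (h *: u + (h *: v + x)) - f (h *: u + x) - f (h *: v + x) + f x =
    fuv (a *: u + (b *: v + x)) * h * h].
Proof.
move=> h0 dfu dfuv S.
have S0 a : 0 <= a <= h -> U (a *: u + x).
  by move=> ah; have := S a 0 ah; rewrite lexx h0 scale0r add0r; apply.
have hh : 0 <= h <= h by rewrite h0 lexx.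
pose phi (t : R) := f (t *: u + (h *: v + x)) - f (t *: u + x).
pose dphi (t : R) := fu (t *: u + (h *: v + x)) - fu (t *: u + x).
have phiE t : 0 <= t <= h -> is_derive t 1 phi (dphi t).
  by move=> th; apply: is_deriveB; apply: is_derive_line; apply: dfu; auto.
have [|||a] := @MVT_segment _ phi dphi 0 h.
- exact: h0.
- by move=> t; rewrite in_itv /= => /andP[t0 th]; apply: phiE; rewrite !ltW.
- apply: derivable_within_continuous => t; rewrite in_itv /= => th.
  exact: (@ex_derive _ _ _ _ _ _ _ (phiE t th)).
rewrite in_itv /= => ah E.
pose psi (s : R) := fu (s *: v + (a *: u + x)).
pose dpsi (s : R) := fuv (s *: v + (a *: u + x)).
have psiE s : 0 <= s <= h -> is_derive s 1 psi (dpsi s).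
  by move=> sh; apply: is_derive_line; apply: dfuv; rewrite addrCA; exact: S.
have [|||b] := @MVT_segment _ psi dpsi 0 h.
- exact: h0.
- by move=> t; rewrite in_itv /= => /andP[t0 th]; apply: psiE; rewrite !ltW.
- apply: derivable_within_continuous => t; rewrite in_itv /= => th.
  exact: (@ex_derive _ _ _ _ _ _ _ (psiE t th)).
rewrite in_itv /= => bh E0.
exists a, b; split => //.
move: E E0; rewrite /phi /psi /dphi /dpsi !scale0r !add0r subr0.
rewrite !(addrCA _ (_ *: v)) => E E'.
by rewrite -E' -E; ring.
Qed.

(** Meant for mean values: the two mixed derivatives will be compared at different points, both
    tending to [x]. *)
Lemma continuous_eq_near (R : realType) (V : normedModType R) (F G : V -> R)
    (x : V) :
  {for x, continuous F} -> {for x, continuous G} ->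
  (forall r : R, 0 < r ->
     exists y z, [/\ ball x r y, ball x r z & F y = G z]) ->
  F x = G x.
Proof.
move=> cF cG FG; apply/eqP; rewrite -subr_eq0 -normr_le0.
suff K : forall e : R, 0 < e -> `|F x - G x| <= e.
  by apply/ler_addgt0Pl => e e0; rewrite addr0 K.
move=> e e0; have e2 : 0 < e / 2 by rewrite divr_gt0.
have /cvgrPdist_lt/(_ _ e2)/nbhs_ballP[r1 /= r10 H1] := cF.
have /cvgrPdist_lt/(_ _ e2)/nbhs_ballP[r2 /= r20 H2] := cG.
have [|y [z [yr zr E]]] := FG (Num.min r1 r2); first by rewrite lt_min r10.
have {}yr : ball x r1 y by apply: le_ball yr; rewrite ge_min lexx.
have {}zr : ball x r2 z by apply: le_ball zr; rewrite ge_min lexx orbT.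
have := ltW (ltrD (H1 _ yr) (H2 _ zr)); rewrite -splitr; apply: le_trans.
by rewrite E [X in _ <= _ + X]distrC -[X in `|X|](subrKA (G z)) ler_normD.
Qed.

(** Schwarz's theorem. The second difference of [f] is symmetric in [u] and [v], and it equals
    [h * h] times either mixed derivative, each taken at some point of a small parallelogram;
    continuity moves both points to [x]. *)
Lemma derive_commute (R : realType) (V : normedModType R) (U : set V)
    (f fu fv fuv fvu : V -> R) (u v x : V) :
  open U -> U x ->
  (forall y, U y -> is_derive y u f (fu y)) ->
  (forall y, U y -> is_derive y v f (fv y)) ->
  (forall y, U y -> is_derive y v fu (fuv y)) ->
  (forall y, U y -> is_derive y u fv (fvu y)) ->
  {for x, continuous fuv} -> {for x, continuous fvu} ->
  fuv x = fvu x.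
Proof.
move=> oU Ux dfu dfv dfuv dfvu cuv cvu.
apply: (continuous_eq_near cuv cvu) => r0' r0'0.
have /nbhs_ballP[r1 /= r10 HU] : nbhs x U by exact: open_nbhs_nbhs.
pose r := Num.min r0' r1.
have r0 : 0 < r by rewrite lt_min r0'0.
have rU y : ball x r y -> U y.
  by move=> yr; apply: HU; apply: le_ball yr; rewrite ge_min lexx orbT.
have rr y : ball x r y -> ball x r0' y.
  by move=> yr; apply: le_ball yr; rewrite ge_min lexx.
(* With [h * M = r / 2] the parallelogram of sides [h *: u] and [h *: v] at [x] stays in the ball of
   radius [r]; the summand 1 keeps [M] positive even if [u] and [v] vanish. *)
pose M := 1 + `|u| + `|v|.
have M0 : 0 < M by rewrite /M -addrA ltr_wpDr// addr_ge0.
pose h := r / 2 / M.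
have h0 : 0 < h by rewrite !divr_gt0.
have B a b : 0 <= a <= h -> 0 <= b <= h -> ball x r (a *: u + (b *: v + x)).
  move=> /andP[a0 ah] /andP[b0 bh].
  rewrite -ball_normE /= distrC addrA addrK.
  apply: (le_lt_trans (ler_normD _ _)); rewrite !normrZ !ger0_norm//.
  apply: (@le_lt_trans _ _ (h * M)); last first.
    by rewrite /h divfK ?gt_eqF// ltr_pdivrMr// mulr_natr mulr2n ltrDl.
  rewrite /M !mulrDr mulr1 -addrA; apply: ler_wpDl; first exact: ltW.
  by apply: lerD; apply: ler_wpM2r.
have B' b a : 0 <= b <= h -> 0 <= a <= h -> ball x r (b *: v + (a *: u + x)).
  by move=> ? ?; rewrite addrCA; exact: B.
have [a [b [ah bh E1]]] := second_difference (ltW h0) dfu dfuv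
   (fun a b ha hb => rU _ (B a b ha hb)).
have [b' [a' [bh' ah' E2]]] := second_difference (ltW h0) dfv dfvu
   (fun a b ha hb => rU _ (B' a b ha hb)).
exists (a *: u + (b *: v + x)), (b' *: v + (a' *: u + x)).
split; [exact/rr/B | exact/rr/B' |].
have h1 : h != 0 by rewrite gt_eqF.
apply: (mulIf h1); apply: (mulIf h1); rewrite -E1 -E2.
by rewrite (addrCA (h *: u)); ring.
Qed.

(* Maximum principle for transport equations: at a maximum of [(q + c) f],
   [f] has vanishing [w]-derivative, hence also vanishing [v]-derivative, which
   the factor [q + c] forbids where [f > 0]. *)
Lemma compact_support_le0 (R : realType) (V : normedModType R)
    (Omega K : set V) (q f : V -> R) (v w : V) :
  open Omega -> compact K -> K `<=` Omega ->
  (forall x, differentiable q x) ->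
  (forall x, 'D_v q x = 1) -> (forall x, 'D_w q x = 0) ->
  (forall x, Omega x -> differentiable f x) ->
  (forall x, Omega x -> ~ K x -> f x = 0) ->
  (forall x, K x -> 'D_w f x = 0 -> 'D_v f x = 0) ->
  forall x, Omega x -> f x <= 0.
Proof.
move=> oO cK KO dq qv qw df f0 fwv x0 Ox0.
rewrite leNgt; apply/negP => fx0.
have Kx0 : K x0.
  by apply: contrapT => nK; move: fx0; rewrite f0 // ltxx.
have K0 : K !=set0 by exists x0.
have cq : {within K, continuous q}.
  apply: continuous_subspaceT => y; exact: differentiable_continuous.
have [c cK' cmin] := compact_EVT_min K0 cK cq.
(* The shift makes the minimum of the weight on [K] equal to 1, so on [K] the product [p * f] is
   positive wherever [f] is. *)
pose p := q + cst (1 - q c).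
have p1 y : K y -> 1 <= p y.
  by move=> Ky; rewrite /p [leRHS]addrCA lerDl subr_ge0 cmin // inE.
have dp y : differentiable p y.
  exact: differentiableD.
have Dp e y : 'D_e p y = 'D_e q y.
  by rewrite deriveD ?derive_cst ?addr0//; exact: diff_derivable.
have dpf y : Omega y -> differentiable (p * f) y.
  by move=> Oy; apply: differentiableM => //; exact: df.
have cpf : {within K, continuous (p * f)}.
  apply: continuous_in_subspaceT => y /[!inE] /KO Oy.
  exact/differentiable_continuous/dpf.
have [m /[!inE] Km mmax] := compact_EVT_max K0 cK cpf.
have Om := KO _ Km.
have pm0 : 0 < (p * f) m.
  apply: (@lt_le_trans _ _ ((p * f) x0)); last by apply: mmax; rewrite inE.
  by apply: mulr_gt0 => //; apply: lt_le_trans (p1 _ Kx0).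
have pm : 0 < p m by apply: lt_le_trans (p1 _ Km).
have nO : \forall y \near m, Omega y by exact: open_nbhs_nbhs.
(* [m] is a local maximum in [Omega] and not only in [K]: off [K] the product vanishes, while its
   value at [m] is positive. *)
have D0 e : 'D_e (p * f) m = 0.
  apply: derive_local_max.
    by apply: filterS nO => y /dpf; exact: diff_derivable.
  apply: filterS nO => y Oy; have [Ky|nK] := pselect (K y).
    by apply: mmax; rewrite inE.
  by rewrite {1}/GRing.mul /= f0 // mulr0 ltW.
have {D0} D e : p m * 'D_e f m + f m * 'D_e q m = 0.
  rewrite -Dp -[RHS](D0 e) deriveM //; apply: diff_derivable => //; exact: df.
have := D w; rewrite qw mulr0 addr0 => /eqP; rewrite mulf_eq0 gt_eqF//= => /eqP.
move/(fwv _ Km) => Dv; have := D v; rewrite Dv qv mulr0 add0r mulr1 => fm.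
by move: pm0; rewrite /GRing.mul /= fm mulr0 ltxx.
Qed.

(** The hypotheses are invariant under [f -> - f], so the one-sided bound holds for both signs. *)
Lemma compact_support_eq0 (R : realType) (V : normedModType R)
    (Omega K : set V) (q f : V -> R) (v w : V) :
  open Omega -> compact K -> K `<=` Omega ->
  (forall x, differentiable q x) ->
  (forall x, 'D_v q x = 1) -> (forall x, 'D_w q x = 0) ->
  (forall x, Omega x -> differentiable f x) ->
  (forall x, Omega x -> ~ K x -> f x = 0) ->
  (forall x, K x -> 'D_w f x = 0 -> 'D_v f x = 0) ->
  forall x, Omega x -> f x = 0.
Proof.
move=> oO cK KO dq qv qw df f0 fwv x Ox; apply/eqP; rewrite eq_le.
rewrite (compact_support_le0 oO cK KO dq qv qw df f0 fwv) //=.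
rewrite -oppr_le0 -[X in X <= _]/((- f) x).
apply: (compact_support_le0 oO cK KO dq qv qw) => //.
- by move=> y Oy; apply: differentiableN; exact: df.
- move=> y Oy nK; have -> : (- f) y = - f y by [].
  by rewrite f0 // oppr0.
- move=> y Ky; have dfy e : derivable f y e by apply/diff_derivable/df/KO.
  rewrite !deriveN// => /eqP; rewrite oppr_eq0 => /eqP /(fwv _ Ky) ->.
  exact: oppr0.
Qed.

(** * Linear algebra of the Engel frame and of 2-vectors of degree 3 *)

Lemma ord4P (P : 'I_4 -> Prop) : P 0 -> P 1 -> P 2 -> P 3 -> forall i, P i.
Proof.
move=> P0 P1 P2 P3 [[|[|[|[|//]]]] Hi].
- by rewrite (_ : Ordinal Hi = 0) //; exact: val_inj.
- by rewrite (_ : Ordinal Hi = 1) //; exact: val_inj.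
- by rewrite (_ : Ordinal Hi = 2) //; exact: val_inj.
- by rewrite (_ : Ordinal Hi = 3) //; exact: val_inj.
Qed.

Lemma ord2P (P : 'I_2 -> Prop) : P 0 -> P 1 -> forall i, P i.
Proof.
move=> P0 P1 [[|[|//]] Hi].
- by rewrite (_ : Ordinal Hi = 0) //; exact: val_inj.
- by rewrite (_ : Ordinal Hi = 1) //; exact: val_inj.
Qed.

Lemma sum_ord4 (R : realType) (F : 'I_4 -> R) :
  \sum_(i < 4) F i = F 0 + F 1 + F 2 + F 3.
Proof.
rewrite !big_ord_recl big_ord0 addr0 -!addrA.
by congr (F _ + (F _ + (F _ + F _))); exact: val_inj.
Qed.

Section Engel.
Variable R : realType.
Implicit Types (p u v : 'rV[R]_4).

Lemma vec4E (a b c d : R) : (vec4 a b c d 0 0 = a) * (vec4 a b c d 0 1 = b) *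
  (vec4 a b c d 0 2 = c) * (vec4 a b c d 0 3 = d).
Proof. by rewrite !mxE. Qed.

Lemma engel_frame_unit p : engel_frame p \in unitmx.
Proof.
(* The frame is upper unitriangular, whereas [det_trig] is about lower triangular matrices. *)
rewrite unitmxE -det_tr det_trig.
  apply: unitr_prod => i _; rewrite !mxE; move: i.
  by apply: ord4P; rewrite /engel_X /= !mxE /= unitr1.
apply/is_trig_mxP; apply: ord4P; apply: ord4P => //= _;
  by rewrite !mxE /engel_X /= ?mxE.
Qed.

Lemma mul_engel_frame p (c : 'rV[R]_4) : c *m engel_frame p =
  vec4 (c 0 0) (c 0 1) (c 0 2 + p 0 0 * c 0 1) (c 0 3 + p 0 2 * c 0 1).
Proof.
apply/rowP; apply: ord4P; rewrite vec4E ?mxE ?sum_ord4 ?mxE /engel_X /= ?mxE /=;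
  ring.
Qed.

Lemma engel_coordK p u : engel_coord p u *m engel_frame p = u.
Proof. by rewrite /engel_coord mulmxKV// engel_frame_unit. Qed.

(** The entries are those of the dual coframe [dx_0, dx_1, dx_2 - x_0 dx_1, dx_3 - x_2 dx_1].
    Multiplying back by the frame checks them without computing its inverse. *)
Lemma engel_coordE p u : engel_coord p u =
  vec4 (u 0 0) (u 0 1) (u 0 2 - p 0 0 * u 0 1) (u 0 3 - p 0 2 * u 0 1).
Proof.
apply: (can_inj (mulmxK (engel_frame_unit p))).
rewrite engel_coordK mul_engel_frame !vec4E !subrK.
by apply/rowP; apply: ord4P; rewrite !vec4E.
Qed.

(* A wedge of degree at most 3 has no component along [X_i /\ X_3], whose degree
   is at least 4, so the plane lies in the kernel of the coframe dual to [X_3],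
   namely [dx_3 - x_2 dx_1] (coordinates numbered from 0). *)
Lemma wedge_degree_le3 p (A : 'M[R]_(2, 4)) :
  row_free A -> (wedge_degree p (row 0%R A) (row 1%R A) <= 3)%N ->
  forall i, A i 3 = p 0 2 * A i 1.
Proof.
move=> fA deg.
pose a := engel_coord p (row 0%R A); pose b := engel_coord p (row 1%R A).
have W (i : 'I_4) : (i < 3)%N -> a 0 i * b 0 3 = a 0 3 * b 0 i.
  move=> i3; apply/eqP; rewrite -subr_eq0; apply: contraTT deg => H.
  rewrite -ltnNge /wedge_degree.
  apply: leq_trans (leq_bigmax_cond (i, 3 : 'I_4) _) => /=.
    by move: i i3 {H}; apply: ord4P.
  by rewrite i3.
(* The vanishing minors give a linear relation between the two rows with coefficients [b 0 3] and
   [- a 0 3]; independence of the rows makes both coefficients zero. *)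
have W' : b 0 3 *: a = a 0 3 *: b.
  by apply/rowP; apply: ord4P; rewrite [LHS]mxE [RHS]mxE mulrC //; exact: W.
have E : b 0 3 *: row 0%R A - a 0 3 *: row 1%R A = 0.
  have [E0 E1] : row 0%R A = a *m engel_frame p /\
      row 1%R A = b *m engel_frame p.
    by rewrite !engel_coordK.
  by rewrite E0 E1 [X in X - _]scalemxAl [X in _ - X]scalemxAl W' subrr.
pose c : 'rV[R]_2 := \row_i [:: b 0 3; - a 0 3]`_i.
have [c0 c1] : c 0 0 = b 0 3 /\ c 0 1 = - a 0 3 by rewrite !mxE.
have /eqP : c *m A = 0.
  rewrite mulmx_sum_row big_ord_recl big_ord1.
  rewrite (_ : ord0 = 0) // (_ : lift 0 0 = 1); last exact: val_inj.
  by rewrite c0 c1 scaleNr E.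
rewrite mulmx_free_eq0 // => /eqP cE.
move: c0 c1; rewrite cE [LHS]mxE => /esym b0; rewrite [LHS]mxE => /esym/eqP.
rewrite oppr_eq0 /a engel_coordE vec4E subr_eq0 => /eqP a3.
move: b0 => /eqP; rewrite /b engel_coordE vec4E subr_eq0 => /eqP b3.
rewrite !mxE in a3 b3.
by apply: ord2P.
Qed.

(** The contact relation is linear in the tangent vector, so it passes from the rows of the Jacobian
    to all directions. *)
Lemma degree_le3_contact (Phi : 'rV[R]_2 -> 'rV[R]_4) (x : 'rV[R]_2) :
  differentiable Phi x -> row_free (jacobian Phi x) ->
  (degree_at Phi x <= 3)%N ->
  forall v : 'rV[R]_2, 'D_v Phi x 0 3 = Phi x 0 2 * 'D_v Phi x 0 1.
Proof.
move=> dP fJ deg v; rewrite deriveEjacobian // !mxE mulr_sumr.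
apply: eq_bigr => i _; rewrite mulrCA; congr (_ * _).
exact: wedge_degree_le3 fJ deg i.
Qed.

(* The velocity [u] lies in the plane spanned by the rows of [A], to which it is
   orthogonal. *)
Lemma normal_eq0 (g : 'rV[R]_4 -> 'M[R]_4) p u (A : 'M[R]_(2, 4)) :
  riemannian_metric g -> row_free A ->
  (forall i, A i 1 = 0) -> (forall i, A i 3 = 0) -> u 0 1 = 0 -> u 0 3 = 0 ->
  (forall i, inner g p u (row i A) = 0) -> u = 0.
Proof.
move=> [_ _ gpos] fA A1 A3 u1 u3 uA.
(* The rows of [B] are the basis vectors 0 and 2, which span the plane where coordinates 1 and 3
   vanish. *)
pose B : 'M[R]_(2, 4) := \matrix_(i, j) ((j : nat) == i.*2)%:R.
have subB m (C : 'M[R]_(m, 4)) :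
    (forall i, C i 1 = 0) -> (forall i, C i 3 = 0) ->
    (C <= B)%MS.
  move=> C1 C3; apply/submxP; exists (\matrix_(i, j) C i (inord j.*2)).
  apply/matrixP => i; apply: ord4P; rewrite !mxE !big_ord_recl big_ord0 !mxE /=
    ?C1 ?C3 ?(mulr0, mulr1, addr0, add0r) //; congr (C _ _);
    by apply: val_inj; rewrite /= inordK.
(* [A] lies in this plane and has rank 2, so it spans the plane. *)
have BA : (B <= A)%MS.
  have AB := subB _ _ A1 A3.
  rewrite -(geq_leqif (mxrank_leqif_sup AB)) (eqP fA).
  exact: rank_leq_row.
have /submxP[D uD] : (u <= A)%MS.
  by apply: submx_trans BA; apply: subB => i; rewrite ord1.
apply/eqP; apply: contraT => /(gpos p); rewrite /inner.
suff -> : u *m g p *m u^T = 0 by rewrite mxE ltxx.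
rewrite {2}uD trmx_mul mulmxA (_ : _ *m A^T = 0) ?mul0mx //.
apply/rowP => i; rewrite [RHS]mxE -[RHS](uA i) /inner.
rewrite [LHS]mxE [RHS]mxE; apply: eq_bigr => j _; congr (_ * _).
by rewrite !mxE.
Qed.

(** Only the pair [(0, 2)] has a nonzero coefficient, and its degree is 1 + 2. *)
Lemma wedge_degree_X02 p :
  wedge_degree p (vec4 1 0 0 0) (vec4 0 0 1 0) = 3%N.
Proof.
rewrite /wedge_degree; apply/eqP; rewrite eqn_leq; apply/andP; split.
  apply/bigmax_leqP => [[i j]] /= /andP[+ +].
  rewrite /wedge_coef !engel_coordE !vec4E !(mulr0, subr0).
  move: i; apply: ord4P; move: j; apply: ord4P => //= _; rewrite ?vec4E;
    by rewrite !(mulr0, mul0r, subr0) eqxx.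
apply: leq_trans (leq_bigmax_cond (0 : 'I_4, 2 : 'I_4) _) => //=.
rewrite /wedge_coef !engel_coordE !vec4E !(mulr0, subr0, mulr1).
by rewrite oner_neq0.
Qed.

End Engel.

(** * Surfaces on which the contact form vanishes *)

Lemma is_derive_coord (R : realType) (V : normedModType R) (n : nat)
    (F : V -> 'rV[R]_n) (x v : V) (j : 'I_n) :
  derivable F x v -> is_derive x v (fun y => F y 0 j) ('D_v F x 0 j).
Proof.
move=> dF; split; first by move/derivable_mxP: dF.
by rewrite derive_mx // mxE.
Qed.

Lemma Ck2_derive_commute (R : realType) (V : normedModType R) (n : nat)
    (U : set V) (F : V -> 'rV[R]_n) (u v x : V) :
  open U -> Ck U 2 F -> U x ->
  'D_v (fun y => 'D_u F y) x = 'D_u (fun y => 'D_v F y) x.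
Proof.
move=> oU [dF d2F] Ux; apply/rowP => j.
have d1 a y : U y -> is_derive y a (fun z => F z 0 j) ('D_a F y 0 j).
  by move=> Uy; apply: is_derive_coord; apply/diff_derivable/dF.
have d2 a b y : U y -> is_derive y a (fun z => 'D_b F z 0 j)
    ('D_a (fun z => 'D_b F z) y 0 j).
  move=> Uy; apply: is_derive_coord; apply: diff_derivable.
  by have [+ _] := d2F b; apply.
have c2 a b : {for x, continuous (fun y => 'D_a (fun z => 'D_b F z) y 0 j)}.
  have [_ /(_ a)/(_ x Ux) c] := d2F b.
  apply: (@continuous_comp _ _ _ (fun y => 'D_a (fun z => 'D_b F z) y)
     (fun M : 'rV[R]_n => M 0 j)) => //.
  exact: coord_continuous.
exact: (derive_commute oU Ux (d1 u) (d1 v) (d2 v u) (d2 u v)).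
Qed.

Section ContactSurface.
Variables (R : realType) (Omega K : set 'rV[R]_2).
Hypotheses (oO : open Omega) (cK : compact K) (KO : K `<=` Omega).
Variable F : 'rV[R]_2 -> 'rV[R]_4.
Hypothesis F_Ck : Ck Omega 2 F.
Hypothesis contact : forall x, Omega x ->
  forall v : 'rV[R]_2, 'D_v F x 0 3 = F x 0 2 * 'D_v F x 0 1.
Hypothesis F_out : forall x, Omega x -> ~ K x -> F x 0 1 = 0 /\ F x 0 3 = 0.
Let e1 : 'rV[R]_2 := delta_mx 0 0.
Let e2 : 'rV[R]_2 := delta_mx 0 1.
Hypothesis F_w : forall x, K x -> 'D_e2 F x 0 2 != 0.

Let dF x v : Omega x -> derivable F x v.
Proof. by move=> Ox; apply: diff_derivable; exact: (proj1 F_Ck). Qed.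

(** Differentiating the contact relation gives [D_a D_b F_3 = F_2 D_a D_b F_1 + D_b F_1 D_a F_2].
    Exchanging [a] and [b] cancels the second derivatives and leaves the wedge. *)
Lemma contact_wedge x (u v : 'rV[R]_2) : Omega x ->
  'D_u F x 0 1 * 'D_v F x 0 2 = 'D_v F x 0 1 * 'D_u F x 0 2.
Proof.
move=> Ox.
have d2 a b j : is_derive x a (fun z => 'D_b F z 0 j)
    ('D_a (fun z => 'D_b F z) x 0 j).
  apply: is_derive_coord; apply: diff_derivable.
  by have [+ _] := proj2 F_Ck b; apply.
have D a b : 'D_a (fun z => 'D_b F z) x 0 3 =
    F x 0 2 * 'D_a (fun z => 'D_b F z) x 0 1 + 'D_b F x 0 1 * 'D_a F x 0 2.
  rewrite -(@derive_val _ _ _ _ _ _ _ (d2 a b 3)).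
  have dF2 := is_derive_coord (2 : 'I_4) (dF (v := a) Ox).
  have /@derive_val <- := is_deriveM dF2 (d2 a b 1); apply: near_eq_derive.
  have : \forall y \near x, Omega y by exact: open_nbhs_nbhs.
  by apply: filterS => y Oy; rewrite contact.
have cancel (k X Y A B : R) : k * X + A = k * Y + B -> X = Y -> A = B.
  by move=> E XY; move: E; rewrite XY => /addrI.
have E j := congr1 (fun M : 'rV[R]_4 => M 0 j)
  (Ck2_derive_commute u v oO F_Ck Ox).
exact: cancel (etrans (esym (D v u)) (etrans (E 3) (D u v))) (E 1).
Qed.

(** The weight for the maximum principle: slope 1 along [e1], constant along [e2], the direction in
    which [F_w] controls [F_2]. *)
Let q (x : 'rV[R]_2) : R := x 0 0.
Let dq x : differentiable q x. Proof. exact: differentiable_coord. Qed.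
Let Dq x v : 'D_v q x = v 0 0.
Proof.
have dx : derivable (@id 'rV[R]_2) x v by exact: derivable_id.
by have /@derive_val -> := is_derive_coord (0 : 'I_2) dx; rewrite derive_id.
Qed.

(** By [F_w] and [contact_wedge], on [K] the [e1]-derivative of [F_1] vanishes wherever its
    [e2]-derivative does, which is what the maximum principle asks. *)
Lemma contact_flat x : Omega x -> F x 0 1 = 0 /\ F x 0 3 = 0.
Proof.
have DF y v j : Omega y -> 'D_v (fun z => F z 0 j) y = 'D_v F y 0 j.
  by move=> Oy; apply: derive_val; exact/is_derive_coord/dF.
have dFj j y : Omega y -> differentiable (fun z => F z 0 j) y.
  move=> Oy.
  apply: (@differentiable_comp _ _ _ _ F (fun M : 'rV[R]_4 => M 0 j)).
    exact: (proj1 F_Ck).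
  exact: differentiable_coord.
have q1 y : 'D_e1 q y = 1 by rewrite Dq /e1 mxE !eqxx.
have q2 y : 'D_e2 q y = 0 by rewrite Dq /e2 mxE.
have aux (a b c d : R) : a * b = c * d -> b != 0 -> c = 0 -> a = 0.
  move=> E b0 c0; move/eqP: E; rewrite c0 mul0r mulf_eq0 (negbTE b0) orbF.
  by move/eqP.
have F1 y : Omega y -> F y 0 1 = 0.
  apply: (compact_support_eq0 oO cK KO dq q1 q2 (dFj 1)) => z.
    by move=> Oz /(F_out Oz)[].
  move=> Kz; have Oz := KO Kz.
  rewrite (DF z e1 1 Oz) (DF z e2 1 Oz).
  exact: aux (contact_wedge e1 e2 Oz) (F_w Kz).
have D1 y v : Omega y -> 'D_v F y 0 1 = 0.
  move=> Oy; rewrite -DF // -(derive_cst (0 : R) y v); apply: near_eq_derive.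
  have : \forall z \near y, Omega z by exact: open_nbhs_nbhs.
  by apply: filterS => z; exact: F1.
move=> Ox; split; first exact: F1.
(* Since [F_1] is zero, the contact relation kills all first derivatives of [F_3]; the maximum
   principle then gives [F_3 = 0] with no appeal to connectedness of [Omega]. *)
apply: (compact_support_eq0 oO cK KO dq q1 q2 (dFj 3)) Ox => z.
  by move=> Oz /(F_out Oz)[].
by move=> /KO Oz _; rewrite DF // contact // D1 // mulr0.
Qed.

End ContactSurface.

(** * Smoothness, immersivity and degree of [Upsilon] *)

Lemma Ck_cst (R : realType) (V W : normedModType R) (U : set V)
    (k : nat) (c : W) :
  Ck U k (cst c : V -> W).
Proof.
elim: k c => [|k IH] c /=; first by move=> x _; exact: cvg_cst.
split=> [x _ //|v].
rewrite (_ : (fun x => _) = cst 0 :> (V -> W)) //.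
by apply/funext => x; rewrite derive_cst.
Qed.

Section Upsilon.
Variable R : realType.
Local Notation Upsilon := (@Upsilon R).

Lemma Upsilon_differentiable x : differentiable Upsilon x.
Proof.
have -> : Upsilon =
    (fun y : 'rV[R]_2 => y 0 0 *: vec4 1 0 0 0 + y 0 1 *: vec4 0 0 1 0).
  apply/funext => y; apply/rowP.
  by apply: ord4P; rewrite !mxE /= !(mulr0, mulr1, addr0, add0r).
by apply: differentiableD; apply: differentiableZl; exact: differentiable_coord.
Qed.

Lemma derive_Upsilon x v : 'D_v Upsilon x = Upsilon v.
Proof.
have dx : derivable (@id 'rV[R]_2) x v by exact: derivable_id.
have D j : 'D_v (fun y : 'rV[R]_2 => y 0 j) x = v 0 j.
  by have /@derive_val -> := is_derive_coord j dx; rewrite derive_id.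
apply/rowP => j.
have dU : derivable Upsilon x v.
  exact/diff_derivable/Upsilon_differentiable.
have /@derive_val <- := is_derive_coord j dU.
move: j; apply: ord4P; rewrite vec4E.
- rewrite (_ : (fun y => _) = (fun y : 'rV[R]_2 => y 0 0)); first exact: D.
  by apply/funext => y; rewrite vec4E.
- rewrite (_ : (fun y => _) = cst 0); first exact: derive_cst.
  by apply/funext => y; rewrite vec4E.
- rewrite (_ : (fun y => _) = (fun y : 'rV[R]_2 => y 0 1)); first exact: D.
  by apply/funext => y; rewrite vec4E.
- rewrite (_ : (fun y => _) = cst 0); first exact: derive_cst.
  by apply/funext => y; rewrite vec4E.
Qed.

Lemma Upsilon_smooth U : smooth U Upsilon.
Proof.
case=> [|k] /=.
  by move=> x _; exact/differentiable_continuous/Upsilon_differentiable.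
split=> [x _|v]; first exact: Upsilon_differentiable.
rewrite (_ : (fun x => _) = cst (Upsilon v)); first exact: Ck_cst.
by apply/funext => x; rewrite derive_Upsilon.
Qed.

Lemma row_jacobian (F : 'rV[R]_2 -> 'rV[R]_4) x i : differentiable F x ->
  row i (jacobian F x) = 'D_(delta_mx 0 i) F x.
Proof. by move=> dF; rewrite rowE deriveEjacobian. Qed.

Lemma tangent_Upsilon x i : tangent Upsilon x i = Upsilon (delta_mx 0 i).
Proof.
rewrite /tangent row_jacobian ?derive_Upsilon //.
exact: Upsilon_differentiable.
Qed.

Lemma Upsilon_immersion U : immersion U Upsilon.
Proof.
split=> [|x _]; first exact: Upsilon_smooth.
(* The right inverse of the Jacobian selects coordinates 0 and 2, in which [Upsilon] is the
   identity. *)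
apply/row_freeP; exists (\matrix_(i, j) ((i : nat) == j.*2)%:R).
have JE i j : jacobian Upsilon x i j = Upsilon (delta_mx 0 i) 0 j.
  by rewrite -(tangent_Upsilon x) [RHS]mxE.
apply/matrixP => i j; rewrite mxE sum_ord4 !JE !vec4E [RHS]mxE.
rewrite !mul0r !addr0 ![in LHS]mxE.
by move: i j; apply: ord2P; apply: ord2P;
  rewrite /= !(mulr0, mulr1, addr0, add0r).
Qed.

Lemma degree_Upsilon x : degree_at Upsilon x = 3%N.
Proof.
rewrite /degree_at !tangent_Upsilon.
rewrite (_ : Upsilon (delta_mx 0 0) = vec4 1 0 0 0).
  rewrite (_ : Upsilon (delta_mx 0 1) = vec4 0 0 1 0) ?wedge_degree_X02 //.
  by rewrite /Defs.Upsilon !mxE.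
by rewrite /Defs.Upsilon !mxE.
Qed.

Lemma has_degree_Upsilon U : U !=set0 -> has_degree U Upsilon 3.
Proof.
by case=> x Ux; split=> [y _|]; [|exists x => //]; rewrite degree_Upsilon.
Qed.

End Upsilon.

(** * Space and time slices of a map on a product *)

Lemma derive_slicel (R : realType) (V W : normedModType R) (G : V * R -> W)
    (x v : V) (s : R) :
  'D_v (fun y => G (y, s)) x = 'D_(v, 0) G (x, s).
Proof.
rewrite /derive.
suff -> : (fun h : R => h^-1 *: (((fun y => G (y, s)) \o shift x) (h *: v) -
                                 G (x, s))) =
   (fun h => h^-1 *: ((G \o shift (x, s)) (h *: (v, 0)) - G (x, s))) by [].
apply/funext => h /=; congr (_ *: (G (_, _) - _)).
by rewrite -[RHS]/(h *: (0 : R) + s) scaler0 add0r.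
Qed.

Lemma derive1_slicer (R : realType) (V W : normedModType R) (G : V * R -> W)
    (x : V) (s : R) :
  differentiable G (x, s) -> derivable (fun t => G (x, t)) s 1.
Proof.
move=> /diff_derivable => /(_ (0, 1)); rewrite /derivable.
suff -> : (fun h : R => h^-1 *: (((fun t => G (x, t)) \o shift s) (h *: 1) -
                                 G (x, s))) =
   (fun h => h^-1 *: ((G \o shift (x, s)) (h *: (0, 1)) - G (x, s))) by [].
apply/funext => h /=; congr (_ *: (G (_, _) - _)).
by rewrite -[RHS]/(h *: (0 : V) + x) scaler0 add0r.
Qed.

Lemma is_derive0_eq (R : realType) (f : R -> R) (c r : R) :
  (forall t, ball c r t -> is_derive t 1 f 0) ->
  forall t, ball c r t -> f t = f c.
Proof.
move=> df t bt.
have inb s : Num.min t c <= s <= Num.max t c -> ball c r s.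
  move: bt; rewrite /ball /= ltr_norml ltrBlDr ltrBrDr => /andP[b1 b2].
  rewrite ltr_norml; case: (leP t c) => tc /andP[s1 s2]; apply/andP; split; lra.
have [|||] := @MVT_segment _ f (fun=> 0) (Num.min t c) (Num.max t c).
- by rewrite ge_min !le_max lexx.
- by move=> s; rewrite in_itv /= => /andP[s1 s2]; apply/df/inb; rewrite !ltW.
- apply: derivable_within_continuous => s; rewrite in_itv /= => /inb /df df0.
  exact: (@ex_derive _ _ _ _ _ _ _ df0).
by move=> s _ /eqP; rewrite mul0r subr_eq0; case: (leP t c) => _ /eqP.
Qed.

(** * Variations of [Upsilon]: the set of times at which nothing has moved *)

Section Isolated.
Variables (R : realType) (g : 'rV[R]_4 -> 'M[R]_4) (Omega : set 'rV[R]_2).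
Hypotheses (hg : riemannian_metric g) (Omega_open : open Omega).
Variables (eps delta : R) (Gamma : 'rV[R]_2 -> R -> 'rV[R]_4).
Hypotheses (delta_gt0 : 0 < delta) (delta_le : delta <= eps).
Hypothesis adm : admissible_variation Omega (@Upsilon R) eps delta Gamma.
Hypothesis normal : normal_variation g Omega delta Gamma.

Let G (z : 'rV[R]_2 * R) := Gamma z.1 z.2.

Let G_diff x (s : R) : Omega x -> `|s| < delta -> differentiable G (x, s).
Proof.
move=> Ox sd; have [/(_ 1%N)[+ _] _ _ _] := adm; apply => /=.
by split=> //; exact: lt_le_trans delta_le.
Qed.

Let Gamma_smooth s : `|s| < delta -> smooth Omega (Gamma ^~ s).
Proof. by move=> sd; have [_ _ /(_ s sd)[[]]] := adm. Qed.

Let Gamma_diff x s : Omega x -> `|s| < delta -> differentiable (Gamma ^~ s) x.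
Proof. by move=> Ox /Gamma_smooth/(_ 1%N)[+ _]; apply. Qed.

Let Gamma_free x s :
  Omega x -> `|s| < delta -> row_free (jacobian (Gamma ^~ s) x).
Proof. by move=> Ox sd; have [_ _ /(_ s sd)[[_ +] _] _] := adm; apply. Qed.

Lemma Gamma_contact x s : Omega x -> `|s| < delta -> forall v : 'rV[R]_2,
  'D_v (Gamma ^~ s) x 0 3 = Gamma x s 0 2 * 'D_v (Gamma ^~ s) x 0 1.
Proof.
move=> Ox sd; apply: degree_le3_contact; [exact: Gamma_diff|exact: Gamma_free|].
(* The unchanged degree is 3: the point [x] shows that [Omega] is nonempty, so [Upsilon] does have a
   degree there. *)
have [_ _ /(_ s sd)[_ /(_ 3%N) [+ _]] _] := adm.
by move=> /(_ (has_degree_Upsilon (ex_intro _ x Ox)))[+ _]; apply.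
Qed.

Let flat s := forall x, Omega x -> Gamma x s 0 1 = 0 /\ Gamma x s 0 3 = 0.

Let fixed s := forall x, Omega x -> Gamma x s = Upsilon x.

(** At time [s0] coordinate 2 has [e2]-derivative 1, as for [Upsilon]. Joint continuity keeps it
    nonzero at nearby times, uniformly on the compact [K], and [contact_flat] applies. *)
Lemma flat_near s0 : `|s0| < delta -> fixed s0 ->
  \forall s \near s0, flat s.
Proof.
move=> s0d fx0.
have [/(_ 1%N)[_ G_C1] _ _ [K [cK KO G_out]]] := adm.
pose e2 : 'rV[R]_2 := delta_mx 0 1.
have : \forall s \near s0, K `<=` [set x | 'D_(e2, 0) G (x, s) 0 2 != 0].
  have /compact_near_coveringP cN := cK.
  apply: (cN R (nbhs s0) (fun s x => 'D_(e2, 0) G (x, s) 0 2 != 0)) => x /KO Ox.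
  have cG : {for (x, s0), continuous (fun z => 'D_(e2, 0) G z 0 2)}.
    apply: (@continuous_comp _ _ _ (fun z => 'D_(e2, 0) G z)
       (fun M : 'rV[R]_4 => M 0 2)); last exact: coord_continuous.
    by apply: (G_C1 (e2, 0)) => /=; split=> //; exact: lt_le_trans delta_le.
  have neq0 : 'D_(e2, 0) G (x, s0) 0 2 != 0.
    rewrite -derive_slicel (_ : 'D_e2 _ x = Upsilon e2).
      by rewrite vec4E mxE oner_neq0.
    rewrite -(derive_Upsilon x); apply: near_eq_derive.
    have : \forall y \near x, Omega y by exact: open_nbhs_nbhs.
    by apply: filterS => y; exact: fx0.
  exact: (cvgr_neq0 _ cG neq0).
have : \forall s \near s0, `|s| < delta.
  have c : continuous (fun s : R => `|s|) by exact: norm_continuous.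
  exact: (cvgr_lt _ (c s0) _ s0d).
apply: filterS2 => s sd Ks x Ox.
apply: (contact_flat Omega_open cK KO (F := Gamma ^~ s)) Ox.
- exact: Gamma_smooth.
- by move=> y Oy; exact: Gamma_contact.
- by move=> y Oy nK; rewrite G_out ?vec4E //; exact: lt_le_trans delta_le.
- by move=> y /Ks /=; rewrite -derive_slicel.
Qed.

(** Flatness near [s0] kills coordinates 1 and 3 of the velocity, flatness at [s0] kills those of
    the Jacobian; [normal_eq0] concludes. *)
Lemma velocity_eq0 s0 x : Omega x -> `|s0| < delta ->
  (\forall s \near s0, flat s) -> derive1 (Gamma x) s0 = 0.
Proof.
move=> Ox s0d nflat.
have fs := nbhs_singleton nflat.
have dG : derivable (Gamma x) s0 1 by apply: (derive1_slicer (G_diff Ox s0d)).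
have V j : (forall s, flat s -> Gamma x s 0 j = 0) ->
    derive1 (Gamma x) s0 0 j = 0.
  move=> Hj; rewrite derive1E.
  have /@derive_val <- := is_derive_coord j dG.
  rewrite -[RHS](derive_cst (0 : R) s0 1); apply: near_eq_derive.
  by apply: filterS nflat => s; exact: Hj.
have J i j : (forall y, Omega y -> Gamma y s0 0 j = 0) ->
    jacobian (Gamma ^~ s0) x i j = 0.
  move=> Hj; transitivity (row i (jacobian (Gamma ^~ s0) x) 0 j).
    by rewrite [RHS]mxE.
  rewrite row_jacobian; last exact: Gamma_diff.
  have dx : derivable (Gamma ^~ s0) x (delta_mx 0 i : 'rV[R]_2).
    exact/diff_derivable/Gamma_diff.
  have /@derive_val <- := is_derive_coord j dx.
  rewrite -[RHS](derive_cst (0 : R) x (delta_mx 0 i : 'rV[R]_2)).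
  apply: near_eq_derive.
  have : \forall y \near x, Omega y by exact: open_nbhs_nbhs.
  by apply: filterS => y; exact: Hj.
apply: (normal_eq0 hg (Gamma_free Ox s0d)).
- by move=> i; apply: J => y /fs[].
- by move=> i; apply: J => y /fs[].
- by apply: V => s /(_ x Ox)[].
- by apply: V => s /(_ x Ox)[].
- exact: normal Ox s0d.
Qed.

Lemma fixed_near s0 : `|s0| < delta -> fixed s0 ->
  \forall s \near s0, `|s| < delta /\ fixed s.
Proof.
move=> s0d fx0.
have nd : \forall s \near s0, `|s| < delta.
  have c : continuous (fun s : R => `|s|) by exact: norm_continuous.
  exact: (cvgr_lt _ (c s0) _ s0d).
(* [velocity_eq0] at a time [t] asks for flatness around [t], so flatness near [s0] is upgraded to
   flatness near every [t] close to [s0]. *)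
have nf := near_join (flat_near s0d fx0).
have /nbhs_ballP[r /= r0 H] :
    \forall s \near s0, `|s| < delta /\ \forall t \near s, flat t.
  by apply: filterS2 nd nf.
apply/nbhs_ballP; exists r => //= s bs; split; first by have [] := H _ bs.
move=> x Ox; rewrite -fx0 //; apply/rowP => j.
apply: (is_derive0_eq (f := fun t => Gamma x t 0 j)) bs => t /H[td flat_t].
have dG : derivable (Gamma x) t 1 by apply: (derive1_slicer (G_diff Ox td)).
have := is_derive_coord j dG.
by rewrite -derive1E velocity_eq0 // mxE.
Qed.

Lemma variation_trivial x s : Omega x -> `|s| < delta -> Gamma x s = Upsilon x.
Proof.
move=> Ox sd.
pose A : set R := `](- delta), delta[%classic.
have AE t : A t <-> `|t| < delta by rewrite /A /= in_itv /= ltr_norml.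
pose T : set R := [set t | `|t| < delta /\ fixed t].
have TA : T `<=` A by move=> t [td _]; apply/AE.
have -> // : T = A -> Gamma x s = Upsilon x.
  by move=> TE; have : T s by [rewrite TE; apply/AE]; case=> _; apply.
(* [T] is nonempty, open and relatively closed in the interval [A], hence all of it. *)
have cA : connected A by apply/connected_intervalP; exact: interval_is_interval.
apply: cA.
- exists 0; split; first by rewrite normr0.
  by move=> y Oy; have [_ + _ _] := adm; apply.
- exists T; last by apply/esym/setIidr.
  by rewrite openE => t [td ft]; exact: fixed_near.
(* If a point [y] were displaced at a time in the closure of [T], it would be displaced at all
   nearby times, some of which lie in [T]. *)
- exists (closure T); first exact: closed_closure.
  apply/seteqP; split=> [t Tt|t [/AE td clT]].
    by split; [exact: TA | exact: subset_closure].
  split=> // y Oy; apply/eqP; apply: contrapT => /negP.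
  rewrite -subr_eq0 => ne.
  have cGy : {for t, continuous (Gamma y)}.
    apply/differentiable_continuous/derivable1_diffP.
    exact: (derive1_slicer (G_diff Oy td)).
  have cD : (fun r => Gamma y r - Upsilon y) @ t --> Gamma y t - Upsilon y.
    by apply: cvgB => //; exact: cvg_cst.
  have [r [[_ fr]]] := clT _ (cvgr_neq0 _ cD ne).
  by rewrite /= fr // subrr eqxx.
Qed.

End Isolated.

Theorem proposition7p9 (R : realType) (g : 'rV[R]_4 -> 'M[R]_4)
    (hg : riemannian_metric g) (Omega : set 'rV[R]_2)
    (Omega_open : open Omega) (Omega_bounded : bounded_set Omega) :
  [/\ immersion Omega (@Upsilon R),
      Omega !=set0 -> has_degree Omega (@Upsilon R) 3
    & isolated_immersion g Omega (@Upsilon R)].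
Proof.
split; first exact: Upsilon_immersion.
  exact: has_degree_Upsilon.
move=> eps delta Gamma delta_gt0 delta_le adm normal x s Ox sd.
exact: (variation_trivial hg Omega_open delta_gt0 delta_le adm normal Ox sd).
Qed.
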